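(* Let $p\ge2$, $\theta\ge1$ and $r_0\ge0$, and write $\phi_p(t)=|t|^{p-2}t$. Let $h_0,h_0'\in\mathbb R$, with $h_0'=0$ if $r_0=0$. Then there exists a unique $\varphi\in C^1[r_0,+\infty)$ with $r^{\theta-1}\phi_p(\varphi')\in C^1[r_0,+\infty)$ solving \[ (r^{\theta-1}\phi_p(\varphi'))'+r^{\theta-1}\phi_p(\varphi)=0\ \ (r\ge r_0),\qquad \varphi(r_0)=h_0,\ \varphi'(r_0)=h_0'. \] *)

(* Defs.v *)
From HB Require Import structures.
From mathcomp Require Import all_boot all_order all_algebra.
From mathcomp Require Import all_classical all_reals all_analysis.
Set Implicit Arguments. Unset Strict Implicit. Unset Printing Implicit Defensive.
Import Order.TTheory GRing.Theory Num.Theory.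
Import numFieldNormedType.Exports.
Local Open Scope classical_set_scope.
Local Open Scope ring_scope.

Definition phip {R : realType} (p t : R) : R := (`|t| `^ (p - 2)) * t.

(* f has derivative l at x relative to the half-line [a, +oo)
   (one-sided at x = a, two-sided for x > a). *)
Definition has_deriv_from {R : realType} (a : R) (f : R -> R) (x l : R) : Prop :=
  (fun y => (f y - f x) / (y - x)) @ within [set y | a <= y /\ y != x] (nbhs x) --> l.

Definition C1_from_with {R : realType} (a : R) (f df : R -> R) : Prop :=
  (forall x, a <= x -> has_deriv_from a f x (df x)) /\
  {within [set x | a <= x], continuous df}.

Definition is_solution {R : realType} (p theta r0 h0 h0' : R) (phi : R -> R) : Prop :=
  exists dphi dg : R -> R,
    C1_from_with r0 phi dphi /\
    C1_from_with r0 (fun r => r `^ (theta - 1) * phip p (dphi r)) dg /\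
    (forall r, r0 <= r -> dg r + r `^ (theta - 1) * phip p (phi r) = 0) /\
    phi r0 = h0 /\ dphi r0 = h0'.

(* Main.v *)
(** Write [G = r^(theta-1) phi_p(f')], so that the equation is the first-order system
    [f' = phi_p^-1(r^(1-theta) G)], [G' = - r^(theta-1) phi_p(f)], whose right-hand side is
    neither Lipschitz (for [p > 2]) nor regular at [r = 0].

    Existence.  Cut [f] off at an explicit height [K(r)] and [r^(1-theta) G] at
    [r b K(r)^(p-1)]; the cut-off system is continuous up to [r = 0] and locally bounded, so
    Peano's theorem applies (limit of Euler polygons along an ultrafilter).  [K] is chosen with
    [K' >= (r b K^(p-1))^(1/(p-1))], which makes the cut-offs inactive on the solution.

    Uniqueness.  By continuous induction it is enough to work on a short interval [[a, a + d]]
    to the right of a point where two solutions agree.  If [G(a)] or [f(a)] is nonzero, then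
    [|G|] is bounded below by a multiple of [mass a r = (r^theta - a^theta) / theta], which
    keeps [phi_p^-1] away from its singularity just enough for a contraction estimate on [f].
    If both vanish, homogeneity of the equation gives [max |f| <= d max |f|]. *)

Require Import Defs.
From HB Require Import structures.
From mathcomp Require Import all_boot all_order all_algebra.
From mathcomp Require Import all_classical all_reals all_analysis.
From mathcomp Require Import ring lra.
Set Implicit Arguments. Unset Strict Implicit. Unset Printing Implicit Defensive.
Import Order.TTheory GRing.Theory Num.Theory.
Import numFieldNormedType.Exports.
Local Open Scope classical_set_scope.
Local Open Scope ring_scope.

(** * Peano's theorem for finite systems *)

(** A cluster point exists by compactness, and a cluster point of an ultrafilter is a limit. One [U]
    serves all times and components at once, so no subsequences are extracted. *)
Lemma ultra_limit (R : realType) (U : set_system nat) (u : R^nat) (a b : R) :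
  UltraFilter U -> (forall n, a <= u n <= b) -> exists l : R, u n @[n --> U] --> l.
Proof.
move=> UU uab; have [l [_ ul]] : `[a, b]%classic `&` cluster (fmap u U) !=set0.
  apply: (@segment_compact R a b (fmap u U) _).
  by apply: (@filterE _ U) => n; rewrite /preimage /= in_itv /=; exact: uab.
exists l => V Vl; have [//|UV] := in_ultra_setVsetC (u @^-1` V) UU.
by have [y []] := ul (~` V) V UV Vl.
Qed.

Section Peano.
Context (R : realType) (I : finType).
Variables (F : I -> R -> (I -> R) -> R) (M : R -> R) (t0 : R) (x0 : I -> R).
(** The bound is uniform in the state, so the Euler scheme cannot blow up and the solution exists
    for all [t >= t0]. *)
Hypothesis F_bound : forall i t T x, t0 <= t -> t <= T -> `|F i t x| <= M T.
Hypothesis F_cont : forall i t x e, t0 <= t -> 0 < e -> exists2 d, 0 < d &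
  forall t' x', t0 <= t' -> `|t' - t| < d -> (forall j, `|x' j - x j| < d) ->
    `|F i t' x' - F i t x| <= e.

Fixpoint euler (h : R) (k : nat) : I -> R :=
  if k is k'.+1 then
    fun i => euler h k' i + h * F i (t0 + k'%:R * h) (euler h k')
  else x0.

Definition mesh (n : nat) : R := n.+1%:R^-1.
Definition grid_index (n : nat) (t : R) : nat := Num.truncn ((t - t0) * n.+1%:R).
(** A step function rather than an interpolation: it takes the Euler value at the last grid point
    not after [t]. Its jumps are of the order of the mesh and disappear in the limit. *)
Definition polygon (n : nat) (t : R) : I -> R := euler (mesh n) (grid_index n t).

Lemma mesh_gt0 n : 0 < mesh n. Proof. by rewrite invr_gt0. Qed.

Lemma grid_indexP n t : t0 <= t ->
  (grid_index n t)%:R * mesh n <= t - t0 < (grid_index n t)%:R * mesh n + mesh n.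
Proof.
move=> t0t; have m0 := mesh_gt0 n.
have : 0 <= (t - t0) * n.+1%:R by rewrite mulr_ge0 ?subr_ge0.
move=> /truncn_itv; rewrite -/(grid_index n t) => /andP[h1 h2].
have n0 : (0 : R) < n.+1%:R by [].
rewrite /mesh; apply/andP; split; first by rewrite ler_pdivrMr.
by rewrite -{2}[n.+1%:R^-1]mul1r -mulrDl natr1 ltr_pdivlMr.
Qed.

Lemma grid_index_le n s t : s <= t -> (grid_index n s <= grid_index n t)%N.
Proof. by move=> st; apply: le_truncn; rewrite ler_wpM2r ?lerD2r. Qed.

(** The errors of the single steps add up. With [v = 0] this is a Lipschitz bound; with [v] the
    field at the limit point it leads to the derivative. *)
Lemma euler_increment h j m i v e : 0 <= h -> (j <= m)%N ->
  (forall k, (j <= k < m)%N -> `|F i (t0 + k%:R * h) (euler h k) - v| <= e) ->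
  `|euler h m i - euler h j i - (m - j)%:R * h * v| <= (m - j)%:R * h * e.
Proof.
move=> h0; elim: m => [|m IH] jm H.
  by move: jm; rewrite leqn0 => /eqP ->; rewrite subnn !mul0r !subrr normr0.
move: jm; rewrite leq_eqVlt => /orP[/eqP <-|]; last rewrite ltnS => jm.
  by rewrite subnn !mul0r !subrr normr0.
have {}IH : `|euler h m i - euler h j i - (m - j)%:R * h * v| <= (m - j)%:R * h * e.
  by apply: IH => // k /andP[jk km]; apply: H; rewrite jk; exact: leqW.
rewrite subSn // -natr1 /=.
have Hm : `|F i (t0 + m%:R * h) (euler h m) - v| <= e by apply: H; rewrite jm /=.
set f := F _ _ _ in Hm *.
have -> : euler h m i + h * f - euler h j i - ((m - j)%:R + 1) * h * v =
   (euler h m i - euler h j i - (m - j)%:R * h * v) + h * (f - v) by ring.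
have -> : ((m - j)%:R + 1) * h * e = (m - j)%:R * h * e + h * e by ring.
rewrite (le_trans (ler_normD _ _)) // lerD // normrM ger0_norm //.
exact: ler_wpM2l.
Qed.

Lemma euler_lipschitz h j m i T : 0 <= h -> (j <= m)%N -> t0 + m%:R * h <= T ->
  `|euler h m i - euler h j i| <= (m - j)%:R * h * M T.
Proof.
move=> h0 jm mT.
have := @euler_increment h j m i 0 (M T) h0 jm; rewrite mulr0 subr0; apply.
move=> k /andP[_ km]; rewrite subr0; apply: F_bound.
  by rewrite lerDl mulr_ge0.
by rewrite (le_trans _ mT) // lerD2l ler_wpM2r // ler_nat ltnW.
Qed.

Lemma F_bound_ge0 (i : I) T : t0 <= T -> 0 <= M T.
Proof. by move=> t0T; apply: le_trans (normr_ge0 _) (F_bound i x0 (lexx _) t0T). Qed.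

Lemma polygon_bound n i t : t0 <= t -> `|polygon n t i - x0 i| <= (t - t0) * M t.
Proof.
move=> t0t; have /andP[h1 h2] := grid_indexP n t0t.
have := @euler_lipschitz (mesh n) 0 (grid_index n t) i t (ltW (mesh_gt0 n)) (leq0n _).
rewrite subn0 => /(_ _) /le_trans; apply; first by lra.
by rewrite ler_wpM2r // (F_bound_ge0 i).
Qed.

(** [M (s + 1)] is a Lipschitz constant of the scheme up to time [s + 1]; the smallness conditions
    keep all Euler states met between [a] and [b] within [d / 2] of the state at [s]. The last term
    is the cost of rounding [a] and [b] to the grid. *)
Lemma polygon_increment n i s a b d v e :
  t0 <= s -> t0 <= a -> a <= b -> `|a - s| <= 1 -> `|b - s| <= 1 ->
  `|a - s| + mesh n < d -> `|b - s| < d ->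
  (`|a - s| + mesh n) * M (s + 1) < d / 2 ->
  (`|b - s| + mesh n) * M (s + 1) < d / 2 ->
  (forall t x, t0 <= t -> `|t - s| < d -> (forall j, `|x j - polygon n s j| < d / 2) ->
    `|F i t x - v| <= e) ->
  `|polygon n b i - polygon n a i - (b - a) * v| <=
    (b - a) * e + mesh n * (e + `|v|).
Proof.
move=> t0s t0a ab a1 b1 ad bd aM bM H.
have t0b : t0 <= b by apply: le_trans ab.
have m0 := mesh_gt0 n.
have /andP[s2 s3] := grid_indexP n t0s.
have /andP[a2 a3] := grid_indexP n t0a.
have /andP[b2 b3] := grid_indexP n t0b.
have jm := grid_index_le n ab.
have e0 : 0 <= e.
  apply: le_trans (normr_ge0 _) (H s (polygon n s) t0s _ _).
    by rewrite subrr normr0; apply: le_lt_trans bd.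
  move=> j; rewrite subrr normr0; apply: le_lt_trans bM.
  by rewrite mulr_ge0 ?addr_ge0 ?(ltW m0) ?(F_bound_ge0 i) //; lra.
have K := @euler_increment (mesh n) (grid_index n a) (grid_index n b) i v e (ltW m0) jm _.
have {}K : `|polygon n b i - polygon n a i - (grid_index n b - grid_index n a)%:R * mesh n * v| <=
    (grid_index n b - grid_index n a)%:R * mesh n * e.
  apply: K => k /andP[ak kb]; apply: H => [||j].
  - by rewrite lerDl mulr_ge0 ?(ltW m0).
  - have : (grid_index n a)%:R * mesh n <= k%:R * mesh n by rewrite ler_pM2r ?ler_nat.
    have : k%:R * mesh n <= (grid_index n b)%:R * mesh n by rewrite ler_pM2r ?ler_nat // ltnW.
    move: ad bd; have := ler_norm (b - s); have := ler_norm (- (a - s)); rewrite normrN.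
    by move=> *; rewrite ltr_norml; apply/andP; split; lra.
  - have kb' : k%:R * mesh n <= (grid_index n b)%:R * mesh n by rewrite ler_pM2r ?ler_nat // ltnW.
    have ka' : (grid_index n a)%:R * mesh n <= k%:R * mesh n by rewrite ler_pM2r ?ler_nat.
    have nb := ler_norm (b - s); have := ler_norm (- (a - s)); rewrite normrN => na.
    have M0 : 0 <= M (s + 1) by rewrite (F_bound_ge0 i) //; lra.
    (* [euler_lipschitz] compares ordered indices only, so grid points before and after that of [s]
       are treated separately, through [aM] and [bM]. *)
    have [ks|sk] := leqP k (grid_index n s).
      rewrite distrC; apply: le_lt_trans aM.
      apply: (le_trans (@euler_lipschitz _ _ _ _ (s + 1) (ltW m0) ks _)); first by lra.
      by rewrite ler_wpM2r // natrB // mulrBl; lra.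
    apply: le_lt_trans bM.
    apply: (le_trans (@euler_lipschitz _ _ _ _ (s + 1) (ltW m0) (ltnW sk) _)); first by lra.
    by rewrite ler_wpM2r // natrB 1?ltnW // mulrBl; lra.
move: K; rewrite natrB // mulrBl.
set N := _ - _ * mesh n => K.
have N1 : `|N - (b - a)| <= mesh n by rewrite ler_norml; apply/andP; split; rewrite /N; lra.
have -> : polygon n b i - polygon n a i - (b - a) * v =
  (polygon n b i - polygon n a i - N * v) + (N - (b - a)) * v by ring.
rewrite (le_trans (ler_normD _ _)) // normrM.
have : `|N - (b - a)| * `|v| <= mesh n * `|v| by rewrite ler_wpM2r.
have : (N - (b - a)) * e <= mesh n * e by rewrite ler_wpM2r // (le_trans (ler_norm _)).
by lra.
Qed.

Lemma mesh_cvg0 : mesh n @[n --> \oo] --> 0.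
Proof. exact: cvg_harmonic. Qed.

(** The solution is the pointwise limit of the polygons along an ultrafilter; passing to the limit
    in [polygon_increment] controls the difference quotients directly, with no integral equation. *)
Lemma peano : exists X : I -> R -> R, (forall i, X i t0 = x0 i) /\
  forall i t, t0 <= t -> has_deriv_from t0 (X i) t (F i t (fun j => X j t)).
Proof.
have [U [UU sU]] := @ultraFilterLemma nat \oo _.
have limX i t : exists l : R, t0 <= t -> polygon n t i @[n --> U] --> l.
  have [t0t|] := pselect (t0 <= t); last by exists 0.
  have [|l ul] := @ultra_limit R U (fun n => polygon n t i)
    (x0 i - (t - t0) * M t) (x0 i + (t - t0) * M t) UU; last by exists l.
  by move=> n; rewrite -ler_distl; exact: polygon_bound.
pose X i t := projT1 (cid (limX i t)).
have XE i t : t0 <= t -> polygon n t i @[n --> U] --> X i t.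
  by move=> t0t; apply: projT2 (cid (limX i t)) t0t.
have meshU : mesh n @[n --> U] --> 0 by apply: cvg_trans mesh_cvg0 => V; exact: sU.
exists X; split=> [i|i s t0s].
  have h : polygon n t0 i @[n --> U] --> x0 i.
    apply: cvg_near_cst; apply: filterE => n.
    by rewrite /polygon /grid_index subrr mul0r truncn0.
  exact: cvg_unique (XE i t0 (lexx _)) h.
set v := F i s _.
have local_bound e : 0 < e -> exists2 c, 0 < c & forall a b, t0 <= a -> a <= b ->
    `|a - s| < c -> `|b - s| < c -> `|X i b - X i a - (b - a) * v| <= (b - a) * e.
  move=> e0; have [d d0 Fd] := F_cont i (fun j => X j s) t0s e0.
  have M0 : 0 <= M (s + 1) by apply: (F_bound_ge0 i); lra.
  (* The entry 1 keeps times below [s + 1], [d / 2] leaves room for a mesh below [c], and the last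
     entry makes [c * 2 * M (s + 1) < d / 2]; the [+ 1] avoids a division by 0. *)
  pose c := Num.min 1 (Num.min (d / 2) (d / 2 / (M (s + 1) + 1) / 2)).
  have c0 : 0 < c by rewrite !lt_min ltr01 !divr_gt0 //; lra.
  have c1 : c <= 1 by rewrite ge_min lexx.
  have cd : c <= d / 2 by rewrite !ge_min lexx orbT.
  have cM : c * 2 * M (s + 1) < d / 2.
    apply: (@le_lt_trans _ _ ((d / 2 / (M (s + 1) + 1)) * M (s + 1))).
      by rewrite ler_wpM2r // -ler_pdivlMr // !ge_min lexx !orbT.
    by rewrite -mulrA gtr_pMr ?divr_gt0 // mulrC ltr_pdivrMr ?mul1r ?ltrDl ?ltr_wpDl.
  exists c => // a b t0a ab ac bc.
  have t0b := le_trans t0a ab.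
  have dcvg : (fun n => `|polygon n b i - polygon n a i - (b - a) * v|) @ U -->
      `|X i b - X i a - (b - a) * v|.
    by apply: cvg_norm; apply: cvgB; [apply: cvgB; exact: XE|exact: cvg_cst].
  have ecvg : (fun n => (b - a) * e + mesh n * (e + `|v|)) @ U --> (b - a) * e.
    rewrite -[X in _ --> X]addr0; apply: cvgD; first exact: cvg_cst.
    by rewrite -(mul0r (e + `|v|)); apply: cvgM => //; exact: cvg_cst.
  apply: ler_cvg_to dcvg ecvg _.
  have nearX : \forall n \near U, forall j, `|X j s - polygon n s j| < d / 2.
    apply: (@filter_forall nat I (fun j n => `|X j s - polygon n s j| < d / 2) U) => j.
    by have /cvgrPdist_lt := XE j s t0s; apply; rewrite divr_gt0.
  have nearm : \forall n \near U, mesh n < c.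
    by have /cvgr_lt := meshU; apply.
  near=> n.
  have mc : mesh n < c by near: n.
  have m0 := mesh_gt0 n.
  have Xd : forall j, `|X j s - polygon n s j| < d / 2 by near: n.
  apply: (@polygon_increment n i s a b d) => //; try lra.
  - apply: le_lt_trans cM; rewrite ler_wpM2r //; lra.
  - apply: le_lt_trans cM; rewrite ler_wpM2r //; lra.
  move=> t x t0t td xd; apply: Fd => // j.
  rewrite /=; apply: le_lt_trans (ler_distD (polygon n s j) _ _) _.
  by rewrite (distrC _ (X j s)); have := Xd j; have := xd j; lra.
apply/cvgrPdist_le => e /local_bound[c c0 H].
rewrite near_withinE; exists c => // y /=; rewrite distrC => yc [t0y ys].
have ys0 : y - s != 0 by rewrite subr_eq0.
rewrite distrC -(ler_pM2r (_ : 0 < `|y - s|)) ?normr_gt0 // -normrM mulrBl divfK //.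
have s0 : `|s - s| < c by rewrite subrr normr0.
have [sy|sy] := leP s y.
  by rewrite [`|y - s|]ger0_norm ?subr_ge0 // [v * _]mulrC [e * _]mulrC; apply: H.
rewrite [`|y - s|]ltr0_norm ?subr_lt0 // opprB [e * _]mulrC.
have := H y s t0y (ltW sy) yc s0; rewrite -normrN.
by congr (`|_| <= _); ring.
Unshelve. all: by end_near.
Qed.

End Peano.

(** * One-sided derivatives and signed powers *)

Section Calculus.
Context {R : realType}.
Implicit Types (f g df dg : R -> R) (a b l r x : R).

Lemma has_deriv_is_derive r f x l : has_deriv_from r f x l -> r < x ->
  is_derive x 1 f l.
Proof.
move=> /cvgrPdist_le fl rx.
have fl' : (fun h : R => h^-1 *: ((f \o shift x) (h *: 1) - f x)) @ 0^' --> l.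
  apply/cvgrPdist_le => e /fl; rewrite !near_withinE => -[c c0 H].
  have m0 : 0 < Num.min c (x - r) by rewrite lt_min c0 subr_gt0.
  exists (Num.min c (x - r)) => // h /=.
  rewrite sub0r normrN lt_min => /andP[hc hr] h0.
  have := H (h + x); rewrite /= opprD addrCA addrN addr0 normrN => /(_ hc).
  rewrite addrK [_ / h]mulrC /GRing.scale /= mulr1; apply; split.
    by have := ler_norm (- h); rewrite normrN; lra.
  by rewrite -subr_eq0 addrK.
by apply: DeriveDef; [apply/cvg_ex; exists l|exact: cvg_lim fl'].
Qed.

Lemma has_deriv_continuous r f df :
  (forall x, r <= x -> has_deriv_from r f x (df x)) ->
  {within [set x | r <= x], continuous f}.
Proof.
move=> fdf; apply/subspace_continuousP => x /= rx.
have /cvgrPdist_le/(_ 1 ltr01) := fdf x rx.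
rewrite near_withinE => -[c c0 H].
apply/cvgrPdist_le => e e0; rewrite near_withinE.
have K0 : 0 < `|df x| + 1 by rewrite ltr_wpDl.
exists (Num.min c (e / (`|df x| + 1))); first by rewrite /= lt_min c0 divr_gt0.
move=> y /=; rewrite lt_min ltr_pdivlMr // => /andP[yc ye] ry.
have [->|yx] := eqVneq y x; first by rewrite subrr normr0 ltW.
have := H y yc (conj ry yx).
have yx0 : y - x != 0 by rewrite subr_eq0.
set q := _ / _ => q1; have -> : f x - f y = q * (x - y).
  by rewrite /q -[x - y]opprB mulrN divfK // opprB.
rewrite normrM mulrC (le_trans _ (ltW ye)) // ler_wpM2l //.
have -> : q = df x - (df x - q) by ring.
by apply: (le_trans (ler_normB _ _)); rewrite lerD2l.
Qed.

Lemma eq_has_deriv_from a f g x l : a <= x ->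
  (forall y, a <= y -> f y = g y) -> has_deriv_from a f x l -> has_deriv_from a g x l.
Proof.
move=> ax fg; apply: cvg_trans; apply: near_eq_cvg.
by rewrite near_withinE; apply: nearW => y [ay _]; rewrite !fg.
Qed.

(** Mean value theorem for [g + f] and [g - f], whose derivatives are nonnegative. It replaces
    integration of differential inequalities: [g] is an explicit antiderivative of the bound. *)
Lemma norm_increment_le f df g dg a b : a <= b ->
  (forall x, a < x < b ->
    [/\ is_derive x 1 f (df x), is_derive x 1 g (dg x) & `|df x| <= dg x]) ->
  {within `[a, b], continuous f} -> {within `[a, b], continuous g} ->
  `|f b - f a| <= g b - g a.
Proof.
rewrite le_eqVlt => /orP[/eqP <-|ab] H fc gc; first by rewrite !subrr normr0.
have [||c cab E1] := @MVT R (g + f) (fun x => dg x + df x) a b ab.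
- by move=> x; rewrite in_itv /= => /H[fx gx _]; exact: is_deriveD.
- by move=> x; apply: continuousD; [exact: gc|exact: fc].
have [||d dab E2] := @MVT R (g - f) (fun x => dg x - df x) a b ab.
- by move=> x; rewrite in_itv /= => /H[fx gx _]; exact: is_deriveB.
- by move=> x; apply: continuousD; [exact: gc|apply: continuousN; exact: fc].
move: E1 E2; rewrite !fctE => E1 E2.
have ba : 0 < b - a by rewrite subr_gt0.
have [_ _ +] := H c cab; have [_ _ +] := H d dab.
rewrite !ler_norml => /andP[_ hd] /andP[hc _].
have : 0 <= (dg c + df c) * (b - a) by apply: mulr_ge0; [lra|exact: ltW].
have : 0 <= (dg d - df d) * (b - a) by apply: mulr_ge0; [lra|exact: ltW].
by rewrite -E1 -E2 => *; apply/andP; split; lra.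
Qed.

End Calculus.

(** * Signed powers: Lipschitz and inverse Lipschitz estimates *)

Section SignedPower.
Context {R : realType}.
Implicit Types (a p r s t x y B : R).

(** For [0 < a], the odd power |s|^(a-1) s, written through positive and negative parts so that
    exponents below 1 raise no singularity at 0. Both phi_p and its inverse are of this form, with
    exponents [p - 1] and [(p - 1)^-1]. *)
Definition spow a s : R := Num.max s 0 `^ a - Num.max (- s) 0 `^ a.

Lemma spow_ge0E a s : 0 < a -> 0 <= s -> spow a s = s `^ a.
Proof.
move=> a0 s0; rewrite /spow max_l // max_r ?oppr_le0 // powR0 ?subr0 //.
by rewrite gt_eqF.
Qed.

Lemma spowN a s : spow a (- s) = - spow a s.
Proof. by rewrite /spow opprK opprB. Qed.

Lemma spow0 a : spow a 0 = 0.
Proof. by rewrite /spow oppr0 subrr. Qed.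

Lemma spow_norm a s : 0 < a -> `|spow a s| = `|s| `^ a.
Proof.
move=> a0; wlog s0 : s / 0 <= s.
  move=> H; have [|/ltW s0] := leP 0 s; first exact: H.
  by have := H (- s); rewrite spowN !normrN oppr_ge0; exact.
by rewrite spow_ge0E // ger0_norm ?powR_ge0 // ger0_norm.
Qed.

Lemma spowK a s : 0 < a -> spow a (spow a^-1 s) = s.
Proof.
move=> a0; have ai : 0 < a^-1 by rewrite invr_gt0.
wlog s0 : s / 0 <= s.
  move=> H; have [|/ltW s0] := leP 0 s; first exact: H.
  by apply: oppr_inj; have := H (- s); rewrite !spowN oppr_ge0; exact.
by rewrite !spow_ge0E ?powR_ge0 // -powRrM mulVf ?gt_eqF // powRr1.
Qed.

Lemma phipE p t : 2 <= p -> phip p t = spow (p - 1) t.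
Proof.
move=> p2; have p1 : 0 < p - 1 by lra.
wlog t0 : t / 0 <= t.
  move=> H; have [|/ltW t0] := leP 0 t; first exact: H.
  have := H (- t); rewrite spowN /phip normrN mulrN oppr_ge0 => /(_ t0).
  exact: oppr_inj.
rewrite spow_ge0E // /phip ger0_norm // mulrC -[RHS]mulr_powRB1 //.
by congr (_ * _ `^ _); ring.
Qed.

Lemma spow_le_norm a s B : 0 < a -> 0 <= B -> `|spow a s| <= B `^ a -> `|s| <= B.
Proof.
move=> a0 B0; rewrite spow_norm //; apply: contraTT; rewrite -!ltNge => Bs.
by apply: gt0_ltr_powR => //; rewrite nnegrE.
Qed.

Lemma spow_norm_le a s B : 0 < a -> `|s| <= B -> `|spow a s| <= B `^ a.
Proof.
move=> a0 sB; rewrite spow_norm //; apply: ge0_ler_powR; rewrite ?(ltW a0) ?nnegrE //.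
exact: le_trans sB.
Qed.

Lemma powR_lipschitz a B x y : 1 <= a -> 0 <= y -> y <= x -> x <= B ->
  x `^ a - y `^ a <= a * B `^ (a - 1) * (x - y).
Proof.
move=> a1 y0; rewrite le_eqVlt => /orP[/eqP ->|yx xB]; first by rewrite !subrr mulr0.
have a0 : 0 < a by lra.
have B0 : 0 <= B by lra.
have Bx z : 0 <= z -> z <= B -> z `^ (a - 1) <= B `^ (a - 1).
  by move=> z0 zB; apply: ge0_ler_powR; rewrite ?nnegrE ?subr_ge0.
(* The derivative of the power is available only at positive points; for [y = 0] the product x^a = x
   * x^(a-1) is bounded directly. *)
move: y0; rewrite le_eqVlt => /orP[/eqP y0|y0].
  rewrite -y0 powR0 ?gt_eqF // !subr0 -mulr_powRB1 //; last by lra.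
  rewrite mulrC ler_wpM2r //; first by lra.
  by rewrite (le_trans (Bx x _ _)) ?ler_peMl ?powR_ge0 //; lra.
have [||c + ->] := @MVT R (fun t => t `^ a) (fun t => a * t `^ (a - 1)) y x yx.
- by move=> t; rewrite in_itv /= => /andP[yt _]; apply: is_derive1_powR; lra.
- apply: derivable_within_continuous => t; rewrite in_itv /= => /andP[yt _].
  by apply: derivable_powR; rewrite in_itv /= andbT; lra.
rewrite in_itv /= => /andP[yc cx].
rewrite ler_wpM2r ?subr_ge0 ?(ltW yx) // ler_wpM2l ?(ltW a0) // Bx //; lra.
Qed.

Lemma spow_lipschitz a B x y : 1 <= a -> `|x| <= B -> `|y| <= B ->
  `|spow a x - spow a y| <= a * B `^ (a - 1) * `|x - y|.
Proof.
move=> a1; have a0 : 0 < a by lra.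
wlog yx : x y / y <= x.
  move=> H xB yB; have [yx|/ltW] := leP y x; first exact: H.
  by move=> xy; rewrite distrC (distrC x); exact: H.
(* By oddness, [(x, y)] may be replaced by [(- y, - x)]; hence [x] may be taken as the entry of
   larger absolute value. *)
wlog y0 : x y yx / 0 <= x + y.
  move=> H xB yB; have [|/ltW xy0] := leP 0 (x + y); first by move=> ?; exact: H.
  have := H (- y) (- x); rewrite !spowN !normrN.
  have -> : - spow a y - - spow a x = spow a x - spow a y by ring.
  have -> : - y - - x = x - y by ring.
  by apply => //; [rewrite lerN2|lra].
have x0 : 0 <= x by lra.
move=> + yB; rewrite ger0_norm // => xB; rewrite [`|x - y|]ger0_norm ?subr_ge0 //.
rewrite (spow_ge0E _ x0) //; have [y'|/ltW y'] := leP 0 y.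
  rewrite (spow_ge0E _ y') // ger0_norm ?powR_lipschitz // subr_ge0.
  by apply: ge0_ler_powR; rewrite ?nnegrE // ltW.
rewrite -{1}(opprK y) spowN opprK (spow_ge0E _ (_ : 0 <= - y)) ?oppr_ge0 //.
rewrite ger0_norm ?addr_ge0 ?powR_ge0 //.
have zero : 0 `^ a = 0 :> R by rewrite powR0 ?gt_eqF.
have := @powR_lipschitz a B x 0 a1 (lexx _) x0 xB.
have := @powR_lipschitz a B (- y) 0 a1 (lexx _) _ _; rewrite oppr_ge0 zero !subr0 => /(_ y').
by move=> /(_ _) h1 h2; have := h1 ltac:(by lra); rewrite mulrBr mulrN; lra.
Qed.

(** Follows from x^a = x * x^(a-1) and monotonicity of x^(a-1). It says that the inverse power is
    Lipschitz with constant m^(1-a) on arguments at least m^a. *)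
Lemma spow_gap a m x y : 1 <= a -> 0 < m -> m `^ a <= spow a x -> m `^ a <= spow a y ->
  m `^ (a - 1) * `|x - y| <= `|spow a x - spow a y|.
Proof.
move=> a1 m0; have a0 : 0 < a by lra.
have ge_m z : m `^ a <= spow a z -> m <= z.
  move=> mz; rewrite leNgt; apply/negP => zm.
  have [z0|z0] := leP 0 z.
    move: mz; rewrite spow_ge0E // leNgt => /negP; apply.
    by apply: gt0_ltr_powR; rewrite ?nnegrE // ltW.
  have := powR_gt0 a m0; move: mz; rewrite -(opprK z) spowN spow_ge0E //; last by lra.
  by have := powR_ge0 (- z) a; lra.
wlog yx : x y / y <= x.
  move=> H hx hy; have [yx|/ltW xy] := leP y x; first exact: H.
  by rewrite distrC (distrC (spow a x)); exact: H.
move=> /ge_m mx /ge_m my; have x0 : 0 <= x by lra.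
have y0 : 0 <= y by lra.
rewrite !spow_ge0E // ger0_norm ?subr_ge0 // (le_trans _ (ler_norm _)) //.
rewrite -[x `^ a]mulr_powRB1 // -[y `^ a]mulr_powRB1 //.
have xy : y `^ (a - 1) <= x `^ (a - 1).
  by apply: ge0_ler_powR; rewrite ?nnegrE ?subr_ge0.
have ym : m `^ (a - 1) <= y `^ (a - 1).
  by apply: ge0_ler_powR; rewrite ?nnegrE ?subr_ge0 // ltW.
nra.
Qed.

(** The absolute value makes the power continuous on the whole line. For [a = 0], which occurs as
    [theta - 1] when [theta = 1], the function is constantly 1. *)
Lemma continuous_norm_powR a : 0 <= a -> continuous (fun t : R => `|t| `^ a).
Proof.
rewrite le_eqVlt => /orP[/eqP <-|a0] t.
  by rewrite (_ : (fun t => _) = cst 1) ?funeqE => [|?]; [exact: cst_continuous|exact: powRr0].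
have [->|t0] := eqVneq t 0.
  rewrite /continuous_at normr0 powR0 ?gt_eqF //; apply/cvgrPdist_lt => e e0.
  exists (e `^ a^-1); first by rewrite /= powR_gt0.
  move=> y /=; rewrite !sub0r !normrN => ye; rewrite ger0_norm ?powR_ge0 //.
  have -> : e = (e `^ a^-1) `^ a by rewrite -powRrM mulVf ?gt_eqF // powRr1 // ltW.
  by apply: gt0_ltr_powR => //; rewrite nnegrE ?powR_ge0.
apply: (@continuous_comp _ _ _ (fun t : R => `|t|) (fun s => s `^ a)).
  exact: norm_continuous.
apply: differentiable_continuous; apply/derivable1_diffP.
by apply: derivable_powR; rewrite in_itv /= andbT normr_gt0.
Qed.

Lemma continuous_spow a : 0 < a -> continuous (spow a).
Proof.
move=> a0 t.
have -> : spow a = fun s => `|Num.max s 0| `^ a - `|Num.max (- s) 0| `^ a.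
  by apply/funext => s; rewrite /spow !(@ger0_norm _ (Num.max _ 0)) // le_max lexx orbT.
apply: cvgB.
  apply: (@continuous_comp _ _ _ (fun s : R => Num.max s 0) (fun s => `|s| `^ a)).
    by apply: continuous_max; [exact: cvg_id|exact: cvg_cst].
  exact/continuous_norm_powR/ltW.
apply: (@continuous_comp _ _ _ (fun s : R => Num.max (- s) 0) (fun s => `|s| `^ a)).
  by apply: continuous_max; [apply: cvgN; exact: cvg_id|exact: cvg_cst].
exact/continuous_norm_powR/ltW.
Qed.

End SignedPower.

(** * Uniqueness *)

Section Uniqueness.
Context {R : realType}.
Variables (q theta r0 : R).
Hypotheses (q1 : 1 <= q) (theta1 : 1 <= theta) (r00 : 0 <= r0).
Implicit Types (f w h : R -> R) (a b c r s x A D : R).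

Definition flux w r : R := r `^ (theta - 1) * spow q (w r).

(** The equation for the pair [(f, w)], with [w] the derivative of [f] and [q = p - 1]. Continuity
    of [w] is a clause of its own, as the flux does not determine [w] at [r = 0] when the weight
    vanishes there. *)
Definition is_flow f w : Prop :=
  [/\ forall x, r0 <= x -> has_deriv_from r0 f x (w x),
      forall x, r0 <= x ->
        has_deriv_from r0 (flux w) x (- (x `^ (theta - 1) * spow q (f x))) &
      {within [set x | r0 <= x], continuous w}].

(** The integral of s^(theta-1) from [a] to [b]. *)
Definition mass a b : R := (b `^ theta - a `^ theta) / theta.

Lemma theta_gt0 : 0 < theta. Proof. exact: lt_le_trans theta1. Qed.
Lemma q_gt0 : 0 < q. Proof. exact: lt_le_trans q1. Qed.
Lemma ge0_of_ge_r0 a : r0 <= a -> 0 <= a. Proof. exact: le_trans. Qed.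
Let theta0 := theta_gt0.
Let q0 := q_gt0.

Lemma mass_gt0 a b : 0 <= a -> a < b -> 0 < mass a b.
Proof.
move=> a0 ab; rewrite divr_gt0 // subr_gt0.
by apply: gt0_ltr_powR; rewrite ?nnegrE //; lra.
Qed.

(** An instance of [powR_lipschitz]. Dividing by the weight at [b] leaves at most [b - a], uniformly
    down to [a = 0], which absorbs the singular factor r^(1-theta). *)
Lemma mass_le a b : 0 <= a -> a <= b -> mass a b <= b `^ (theta - 1) * (b - a).
Proof.
move=> a0 ab; rewrite ler_pdivrMr // mulrC mulrA.
exact: powR_lipschitz.
Qed.

Lemma within_itvW f a b : r0 <= a -> {within [set x | r0 <= x], continuous f} ->
  {within `[a, b], continuous f}.
Proof.
move=> r0a; apply: continuous_subspaceW => x /=; rewrite in_itv /= => /andP[ax _].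
exact: le_trans ax.
Qed.

Lemma continuous_scaled_powR A a b : 0 <= a ->
  {within `[a, b], continuous (fun r => A * (r `^ theta / theta))}.
Proof.
move=> a0; have : {within `[a, b], continuous (fun r => A * (`|r| `^ theta / theta))}.
  apply: continuous_subspaceT => x; apply: cvgM; first exact: cvg_cst.
  by apply: cvgM; [exact/continuous_norm_powR/ltW|exact: cvg_cst].
apply: subspace_eq_continuous => x; rewrite inE /= in_itv /= => /andP[ax _].
by rewrite /from_subspace (ger0_norm (le_trans a0 ax)).
Qed.

Lemma is_derive_scaled_powR A x : 0 < x ->
  is_derive x 1 (fun r => A * (r `^ theta / theta)) (A * x `^ (theta - 1)).
Proof.
move=> x0.
have -> : (fun r => A * (r `^ theta / theta)) = (A / theta) \*: (fun r => r `^ theta).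
  by apply/funext => r; rewrite /= /GRing.scale /= mulrA mulrAC.
apply: is_derive_eq; first exact: is_deriveZ (is_derive1_powR theta x0).
by rewrite /GRing.scale /= mulrA divfK ?gt_eqF.
Qed.

Lemma flux_increment_le h dh A a b : r0 <= a -> a <= b ->
  (forall x, r0 < x -> is_derive x 1 h (dh x)) ->
  {within `[a, b], continuous h} ->
  (forall x, a < x < b -> `|dh x| <= A * x `^ (theta - 1)) ->
  `|h b - h a| <= A * mass a b.
Proof.
move=> r0a ab hd hc H; have a0 := ge0_of_ge_r0 r0a.
have := @norm_increment_le R h dh _ _ a b ab _ hc (@continuous_scaled_powR A a b a0).
have -> : A * (b `^ theta / theta) - A * (a `^ theta / theta) = A * mass a b.
  by rewrite /mass; ring.
apply => x /andP[ax xb]; split; first by apply: hd; lra.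
  by apply: is_derive_scaled_powR; lra.
by apply: H; rewrite ax.
Qed.

Lemma flux_increment_ge h dh A a b : 0 <= A -> r0 <= a -> a <= b ->
  (forall x, r0 < x -> is_derive x 1 h (dh x)) ->
  {within `[a, b], continuous h} ->
  (forall x, a < x < b -> A * x `^ (theta - 1) <= dh x) ->
  A * mass a b <= h b - h a.
Proof.
move=> A0 r0a ab hd hc H; have a0 := ge0_of_ge_r0 r0a.
have := @norm_increment_le R _ (fun x => A * x `^ (theta - 1)) h dh a b ab _
  (@continuous_scaled_powR A a b a0) hc.
have -> : A * (b `^ theta / theta) - A * (a `^ theta / theta) = A * mass a b.
  by rewrite /mass; ring.
move=> K; apply: le_trans (ler_norm _) (K _) => x /andP[ax xb]; split.
- by apply: is_derive_scaled_powR; lra.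
- by apply: hd; lra.
by rewrite ger0_norm ?mulr_ge0 ?powR_ge0 // H // ax.
Qed.

Section Flow.
Variables (f w : R -> R).
Hypothesis fw : is_flow f w.

Lemma flow_continuous a b : r0 <= a -> {within `[a, b], continuous f}.
Proof. by case: fw => /has_deriv_continuous + _ _ => fc r0a; by apply: within_itvW fc. Qed.

Lemma flow_flux_continuous a b : r0 <= a -> {within `[a, b], continuous (flux w)}.
Proof. by case: fw => _ /has_deriv_continuous + _ => fc r0a; by apply: within_itvW fc. Qed.

Lemma flow_is_derive x : r0 < x -> is_derive x 1 f (w x).
Proof.
by case: fw => fd _ _ r0x; exact: has_deriv_is_derive (fd _ (ltW r0x)) r0x.
Qed.

Lemma flow_flux_is_derive x : r0 < x ->
  is_derive x 1 (flux w) (- (x `^ (theta - 1) * spow q (f x))).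
Proof.
by case: fw => _ fd _ r0x; exact: has_deriv_is_derive (fd _ (ltW r0x)) r0x.
Qed.

Lemma flowN : is_flow (fun x => - f x) (fun x => - w x).
Proof.
have neg (h : R -> R) x l : has_deriv_from r0 h x l ->
    has_deriv_from r0 (fun y => - h y) x (- l).
  rewrite /has_deriv_from => hl.
  have -> : (fun y => (- h y - - h x) / (y - x)) = (fun y => - ((h y - h x) / (y - x))).
    by apply/funext => y; rewrite -opprD mulNr.
  exact: cvgN.
have fluxN : flux (fun x => - w x) = fun x => - flux w x.
  by apply/funext => x; rewrite /flux spowN mulrN.
case: fw => h1 h2 h3; split.
- by move=> x /h1; exact: neg.
- by move=> x /h2 /neg; rewrite fluxN spowN mulrN.
by move=> x; apply: continuousN; exact: h3.
Qed.

(* By homogeneity D := max |f| on [a, a + 1/2] satisfies |w| <= D there, whence D <= D / 2. *)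
Lemma flow_zero a : r0 <= a -> f a = 0 -> flux w a = 0 ->
  forall r, a <= r -> r <= a + 2^-1 -> f r = 0 /\ (a < r -> w r = 0).
Proof.
move=> r0a fa0 ga0; set b := a + 2^-1.
have ab : a <= b by rewrite /b; lra.
have [|c + Dmax] := @EVT_max R (fun x => `|f x|) a b ab.
  move=> x; apply: (@continuous_comp _ _ _ (f : subspace `[a, b] -> R) (fun t : R => `|t|)).
    exact: flow_continuous.
  exact: norm_continuous.
rewrite in_itv /= => /andP[ac cb]; set D := `|f c| in Dmax.
have D0 : 0 <= D by exact: normr_ge0.
have fD x : a <= x -> x <= b -> `|f x| <= D.
  by move=> ax xb; apply: Dmax; rewrite in_itv /= ax.
(* The flux at [r] is at most D^q times [mass a r], and dividing by the weight leaves |w|^q at most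
   D^q (r - a). The case [r = a] is left out because the weight may vanish there. *)
have wD r : a < r -> r <= b -> `|w r| <= D.
  move=> ar rb; have ar' := ltW ar.
  have := @flux_increment_le (flux w) _ (D `^ q) a r r0a ar' flow_flux_is_derive
    (@flow_flux_continuous a r r0a).
  have rt : 0 < r `^ (theta - 1) by rewrite powR_gt0 // (le_lt_trans (ge0_of_ge_r0 r0a) ar).
  rewrite ga0 subr0 => /(_ _)/le_trans K.
  have a0 := ge0_of_ge_r0 r0a.
  have Dq := powR_ge0 D q.
  have := K _ _ (ler_wpM2l Dq (mass_le a0 ar')).
  rewrite /flux normrM ger0_norm ?powR_ge0 // mulrCA ler_pM2l // => {}K.
  apply: (spow_le_norm q0 D0); apply: le_trans (K _) _.
    move=> x /andP[ax xr]; rewrite normrN normrM ger0_norm ?powR_ge0 // mulrC.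
    by rewrite ler_wpM2r ?powR_ge0 // spow_norm_le // fD //; lra.
  rewrite ler_piMr //; move: rb; rewrite /b; lra.
have fD2 r : a <= r -> r <= b -> `|f r| <= D / 2.
  move=> ar rb.
  have := @norm_increment_le R f w (fun x => D * x) (fun=> D) a r ar _
    (@flow_continuous a r r0a).
  rewrite fa0 subr0 -mulrBr => K.
  have : `|f r| <= D * (r - a).
    apply: K; last first.
      apply: continuous_subspaceT => x; apply: cvgM; [exact: cvg_cst|exact: cvg_id].
    move=> x /andP[ax xr]; split; first by apply: flow_is_derive; lra.
      have := @is_deriveZ R R R id D x 1 1 (is_derive_id _ _).
      by rewrite /GRing.scale /= mulr1.
    by apply: wD => //; lra.
  move/le_trans; apply; rewrite ler_wpM2l //; move: rb; rewrite /b; lra.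
have D00 : D = 0 by have := fD2 c ac cb; rewrite -/D; lra.
move=> r ar rb; split=> [|ar'].
  by apply/eqP; rewrite -normr_le0 -D00 fD.
by apply/eqP; rewrite -normr_le0 -D00 wD.
Qed.

End Flow.

(** * Local uniqueness to the right of a point of agreement *)

Lemma within_continuous_near f a e : {within [set x | r0 <= x], continuous f} ->
  r0 <= a -> 0 < e -> exists2 d, 0 < d &
    forall r, a <= r -> r <= a + d -> `|f r - f a| < e.
Proof.
move=> /subspace_continuousP/(_ a) /= fc r0a e0.
have /cvgrPdist_lt/(_ e e0) := fc r0a; rewrite near_withinE => -[d d0 H].
exists (d / 2); first by rewrite divr_gt0.
move=> r ar rd; rewrite distrC; apply: H => /=; last exact: le_trans ar.
have d0' : 0 < d by [].
by rewrite distrC ger0_norm ?subr_ge0 //; lra.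
Qed.

(** A positive flux stays above half its value near [a], while [mass] is bounded. If the flux
    vanishes and [f a < 0], its derivative is nearby at least (-f(a)/2)^q times the weight, and
    [flux_increment_ge] applies. *)
Lemma flow_flux_lower_bound f w a : is_flow f w -> r0 <= a ->
  0 < flux w a \/ flux w a = 0 /\ f a < 0 ->
  exists c d B, [/\ 0 < c, 0 < d &
    forall r, a <= r -> r <= a + d -> c * mass a r <= flux w r /\ `|f r| <= B].
Proof.
move=> fw r0a H; have a0 := ge0_of_ge_r0 r0a; have t1 := theta1.
case: (fw) => /has_deriv_continuous fc /has_deriv_continuous gc _.
have [d1 d10 Hd1] := within_continuous_near fc r0a ltr01.
have fB r : a <= r -> r <= a + d1 -> `|f r| <= `|f a| + 1.
  move=> ar rd; have -> : f r = f a + (f r - f a) by ring.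
  by apply: (le_trans (ler_normD _ _)); rewrite lerD2l ltW // Hd1.
case: H => [ga|[ga fa]].
  have [|d2 d20 Hd2] := @within_continuous_near _ a (flux w a / 2) gc r0a.
    by rewrite divr_gt0.
  pose P := (a + 1) `^ (theta - 1).
  have P0 : 0 < P by rewrite powR_gt0 //; lra.
  exists (flux w a / 2 / P), (Num.min 1 (Num.min d1 d2)), (`|f a| + 1); split.
  - by rewrite !divr_gt0.
  - by rewrite !lt_min ltr01 d10.
  move=> r ar; rewrite -lerBlDl !le_min => /and3P[r1 rd1 rd2]; split; last first.
    by apply: fB => //; lra.
  have rP : r `^ (theta - 1) <= P.
    by apply: ge0_ler_powR; rewrite ?nnegrE; lra.
  have mP : mass a r <= P.
    apply: le_trans (mass_le a0 ar) _; apply: le_trans rP.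
    by rewrite ler_piMr // powR_ge0.
  have := Hd2 r ar; rewrite ltr_norml => /(_ _)/andP[|h _]; first by lra.
  apply: (@le_trans _ _ (flux w a / 2)); last by lra.
  by rewrite mulrAC ler_pdivrMr // ler_wpM2l // divr_ge0 // ltW.
have [|d2 d20 Hd2] := @within_continuous_near _ a (- f a / 2) fc r0a; first by lra.
exists ((- f a / 2) `^ q), (Num.min d1 d2), (`|f a| + 1); split.
- by rewrite powR_gt0 //; lra.
- by rewrite lt_min d10.
move=> r ar; rewrite -lerBlDl !le_min => /andP[rd1 rd2]; split; last first.
  by apply: fB => //; lra.
rewrite -[flux w r]subr0 -ga.
apply: (flux_increment_ge (powR_ge0 _ _) r0a ar (flow_flux_is_derive fw)
   (@flow_flux_continuous _ _ fw a r r0a)) => x /andP[ax xr].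
rewrite mulrC -mulrN ler_wpM2l ?powR_ge0 // -spowN.
have := Hd2 x (ltW ax); rewrite ltr_norml => /(_ _)/andP[|_ h]; first by lra.
rewrite spow_ge0E //; last by lra.
by apply: (ge0_ler_powR (ltW q0)); rewrite ?nnegrE; lra.
Qed.

(* The fluxes being at least c * mass, the velocities are at least (c J)^(1/q) with
   J := r^(1-theta) mass a r, and this lower bound is exactly what compensates for the
   degenerate Lipschitz constant of s |-> s^(1/q). *)
Lemma flow_unique_of_lower_bound f1 w1 f2 w2 a c d B :
  is_flow f1 w1 -> is_flow f2 w2 -> r0 <= a -> f1 a = f2 a -> flux w1 a = flux w2 a ->
  0 < c -> 0 < d ->
  (forall r, a <= r -> r <= a + d -> c * mass a r <= flux w1 r /\ `|f1 r| <= B) ->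
  (forall r, a <= r -> r <= a + d -> c * mass a r <= flux w2 r /\ `|f2 r| <= B) ->
  exists2 d', 0 < d' & forall r, a <= r -> r <= a + d' ->
    f1 r = f2 r /\ (a < r -> w1 r = w2 r).
Proof.
move=> fw1 fw2 r0a fE gE c0 d0 H1 H2; have a0 := ge0_of_ge_r0 r0a.
have q0' := q0; have q1' := q1.
(* [L] is the Lipschitz constant of [spow q] on [[- B, B]], [K] the factor in the velocity estimate
   [wD], and [d'] is small enough for [K * d' <= 2^-1], which gives [D <= D / 2]. *)
pose L := q * B `^ (q - 1); have L0 : 0 <= L by rewrite mulr_ge0 ?powR_ge0 ?(ltW q0).
pose K := L * c `^ q^-1 / c.
have K0 : 0 <= K by apply: divr_ge0 (ltW c0); apply: mulr_ge0 L0 (powR_ge0 _ _).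
pose d' := Num.min (Num.min d 1) (2^-1 / (K + 1)).
have K1 : 0 < K + 1 by lra.
have d'0 : 0 < d' by rewrite !lt_min d0 ltr01 divr_gt0.
have [d'd d'1] : d' <= d /\ d' <= 1 by split; rewrite !ge_min lexx ?orbT.
have d'K : K * d' <= 2^-1.
  have : d' * (K + 1) <= 2^-1 by rewrite -ler_pdivlMr // ge_min lexx orbT.
  by lra.
exists d' => //; set b := a + d'.
have ab : a <= b by rewrite /b; lra.
have fc : {within `[a, b], continuous (f1 \- f2)}.
  by move=> x; apply: continuousB; [exact: (flow_continuous fw1)|exact: (flow_continuous fw2)].
have [|e + Dmax] := @EVT_max R (fun x => `|f1 x - f2 x|) a b ab.
  move=> x; apply: (@continuous_comp _ _ _
    ((f1 \- f2) : subspace `[a, b] -> R) (fun t : R => `|t|)).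
    exact: fc.
  exact: norm_continuous.
rewrite in_itv /= => /andP[ae eb]; move: Dmax; move De : `|f1 e - f2 e| => D Dmax.
have D0 : 0 <= D by rewrite -De.
have fD x : a <= x -> x <= b -> `|f1 x - f2 x| <= D.
  by move=> ax xb; apply: Dmax; rewrite in_itv /= ax.
have wD r : a < r -> r <= b -> `|w1 r - w2 r| <= K * D.
  move=> ar rb; have ar' := ltW ar.
  have rd : r <= a + d by move: rb; rewrite /b; lra.
  have t0 : 0 < r `^ (theta - 1) by rewrite powR_gt0 //; lra.
  pose J := mass a r / r `^ (theta - 1).
  have J0 : 0 < J by rewrite divr_gt0 // mass_gt0.
  have J1 : J <= 1.
    rewrite ler_pdivrMr // mul1r (le_trans (mass_le a0 ar')) // ler_piMr ?(ltW t0) //.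
    by move: rb; rewrite /b; lra.
  have massE : mass a r = J * r `^ (theta - 1) by rewrite divfK ?gt_eqF.
  have v1 : c * J <= spow q (w1 r).
    by have [+ _] := H1 r ar' rd; rewrite massE /flux mulrA [X in _ <= X]mulrC ler_pM2r.
  have v2 : c * J <= spow q (w2 r).
    by have [+ _] := H2 r ar' rd; rewrite massE /flux mulrA [X in _ <= X]mulrC ler_pM2r.
  have dv : `|spow q (w1 r) - spow q (w2 r)| <= L * D * J.
    have gc : {within `[a, r], continuous (flux w1 - flux w2)}.
      move=> x; apply: continuousD; first exact: (flow_flux_continuous fw1).
      by apply: continuousN; exact: (flow_flux_continuous fw2).
    have := @flux_increment_le (flux w1 - flux w2) _ (L * D) a r r0a ar'
      (fun x r0x => is_deriveB (flow_flux_is_derive fw1 r0x) (flow_flux_is_derive fw2 r0x)) gc.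
    rewrite !fctE gE subrr subr0 massE mulrA /flux -mulrBr normrM ger0_norm ?powR_ge0 //.
    rewrite [X in X <= _]mulrC ler_pM2r //; apply.
    move=> x /andP[ax xr].
    have -> : - (x `^ (theta - 1) * spow q (f1 x)) - - (x `^ (theta - 1) * spow q (f2 x)) =
        (spow q (f2 x) - spow q (f1 x)) * x `^ (theta - 1) by ring.
    rewrite normrM [X in _ * X]ger0_norm ?powR_ge0 // ler_wpM2r ?powR_ge0 // distrC.
    have [ax' xd xb] : [/\ a <= x, x <= a + d & x <= b] by split; lra.
    apply: (@le_trans _ _ (L * `|f1 x - f2 x|)); last by rewrite ler_wpM2l // fD.
    by apply: spow_lipschitz => //; [case: (H1 x ax' xd)|case: (H2 x ax' xd)].
  (* [m] is the q-th root of the common lower bound [c * J]. [spow_gap] puts m^(q-1) in front of the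
     difference of velocities; since J = m^q / c, this factor cancels and [L * D * m / c] remains,
     with no negative power of [m]. *)
  pose m := (c * J) `^ q^-1.
  have m0 : 0 < m by rewrite powR_gt0 // mulr_gt0.
  have mq : m `^ q = c * J by rewrite -powRrM mulVf ?gt_eqF // powRr1 // ltW // mulr_gt0.
  have mc : m <= c `^ q^-1.
    apply: ge0_ler_powR; rewrite ?nnegrE ?invr_ge0 ?(ltW q0) ?(ltW c0) //.
      by rewrite ltW // mulr_gt0.
    by rewrite ler_piMr // ltW.
  have := spow_gap q1' m0; rewrite mq => /(_ _ _ v1 v2)/le_trans/(_ dv).
  have -> : L * D * J = m `^ (q - 1) * (L * D * m / c).
    transitivity (L * D * (m * m `^ (q - 1)) / c); last by ring.
    by rewrite mulr_powRB1 ?(ltW m0) // mq; field; rewrite gt_eqF.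
  rewrite (ler_pM2l (powR_gt0 _ m0)) => /le_trans; apply.
  have -> : K * D = L * D * c `^ q^-1 / c by rewrite /K; ring.
  by rewrite ler_wpM2r ?invr_ge0 ?(ltW c0) // ler_wpM2l // mulr_ge0.
have fD2 r : a <= r -> r <= b -> `|f1 r - f2 r| <= D / 2.
  move=> ar rb.
  have fc' : {within `[a, r], continuous (f1 - f2)}.
    move=> x; apply: continuousD; first exact: (flow_continuous fw1).
    by apply: continuousN; exact: (flow_continuous fw2).
  have ic : {within `[a, r], continuous (fun x : R => K * D * x)}.
    by apply: continuous_subspaceT => x; apply: cvgM; [exact: cvg_cst|exact: cvg_id].
  have := @norm_increment_le R (f1 - f2) (fun x => w1 x - w2 x) (fun x => K * D * x)
    (fun=> K * D) a r ar _ fc' ic.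
  rewrite !fctE fE subrr subr0 -mulrBr => /(_ _)/le_trans; apply.
    move=> x /andP[ax xr]; split.
    + by apply: is_deriveB; apply: flow_is_derive => //; lra.
    + have := @is_deriveZ R R R id (K * D) x 1 1 (is_derive_id _ _).
      by rewrite /GRing.scale /= mulr1.
    by apply: wD => //; lra.
  have : K * (r - a) <= K * d' by rewrite ler_wpM2l //; move: rb; rewrite /b; lra.
  have -> : K * D * (r - a) = K * (r - a) * D by ring.
  by move=> h; rewrite [D / 2]mulrC ler_wpM2r //; lra.
have D00 : D = 0 by have := fD2 e ae eb; rewrite De; lra.
move=> r ar rb; split=> [|ar']; apply/eqP; rewrite -subr_eq0 -normr_le0.
  by rewrite -D00 fD.
by have := wD r ar' rb; rewrite D00 mulr0.
Qed.

(** Split by the sign of the common flux at [a], then by the sign of [f1 a]: up to [flowN] the signs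
    are those covered by [flow_flux_lower_bound], and zero data fall under [flow_zero]. *)
Lemma flow_local_unique f1 w1 f2 w2 a :
  is_flow f1 w1 -> is_flow f2 w2 -> r0 <= a -> f1 a = f2 a -> w1 a = w2 a ->
  exists2 d, 0 < d & forall r, a <= r -> r <= a + d -> f1 r = f2 r /\ w1 r = w2 r.
Proof.
move=> fw1 fw2 r0a fE wE.
have a0 := ge0_of_ge_r0 r0a.
suff [d d0 H] : exists2 d, 0 < d &
    forall r, a <= r -> r <= a + d -> f1 r = f2 r /\ (a < r -> w1 r = w2 r).
  exists d => // r ar rd; have [fr wr] := H r ar rd; split=> //.
  by move: ar; rewrite le_eqVlt => /orP[/eqP <-|].
have gE : flux w1 a = flux w2 a by rewrite /flux wE.
have positive_case g1 v1 g2 v2 : is_flow g1 v1 -> is_flow g2 v2 -> g1 a = g2 a ->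
    flux v1 a = flux v2 a -> 0 < flux v1 a \/ flux v1 a = 0 /\ g1 a < 0 ->
    exists2 d, 0 < d &
      forall r, a <= r -> r <= a + d -> g1 r = g2 r /\ (a < r -> v1 r = v2 r).
  move=> gv1 gv2 gE' vE H.
  have [c1 [d1 [B1 [c10 d10 H1]]]] := flow_flux_lower_bound gv1 r0a H.
  rewrite vE gE' in H.
  have [c2 [d2 [B2 [c20 d20 H2]]]] := flow_flux_lower_bound gv2 r0a H.
  have m0 r : a <= r -> 0 <= mass a r.
    rewrite le_eqVlt => /orP[/eqP <-|ar]; first by rewrite /mass subrr mul0r.
    exact/ltW/mass_gt0.
  apply: (@flow_unique_of_lower_bound _ _ _ _ a (Num.min c1 c2) (Num.min d1 d2)
    (Num.max B1 B2) gv1 gv2 r0a gE' vE); rewrite ?lt_min ?c10 ?d10 //.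
  - move=> r ar; rewrite -lerBlDl le_min => /andP[rd _].
    have [|h1 h2] := H1 r ar; first by lra.
    by rewrite le_max h2; split=> //; apply: le_trans h1; rewrite ler_wpM2r ?m0 // ge_min lexx.
  - move=> r ar; rewrite -lerBlDl le_min => /andP[_ rd].
    have [|h1 h2] := H2 r ar; first by lra.
    rewrite le_max h2 orbT; split=> //; apply: le_trans h1.
    by rewrite ler_wpM2r ?m0 // ge_min lexx orbT.
have fluxN w : flux (fun x => - w x) a = - flux w a by rewrite /flux spowN mulrN.
have negative_case : 0 < - flux w1 a \/ - flux w1 a = 0 /\ - f1 a < 0 ->
    exists2 d, 0 < d &
      forall r, a <= r -> r <= a + d -> f1 r = f2 r /\ (a < r -> w1 r = w2 r).
  move=> H; have [|||d d0 Hd] := positive_case _ _ _ _ (flowN fw1) (flowN fw2).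
  - by rewrite fE.
  - by rewrite !fluxN gE.
  - by rewrite fluxN.
  exists d => // r ar rd; have [/oppr_inj h1 h2] := Hd r ar rd; split=> // /h2.
  exact: oppr_inj.
have [g0|g0|g0] := ltgtP (flux w1 a) 0.
- by apply: negative_case; left; rewrite oppr_gt0.
- by apply: positive_case => //; left.
have [f0|f0|f0] := ltgtP (f1 a) 0.
- by apply: positive_case => //; right.
- by apply: negative_case; right; rewrite g0 oppr0 oppr_lt0.
exists 2^-1 => [|r ar rd]; first by rewrite invr_gt0.
have [h1 h2] := flow_zero fw1 r0a f0 g0 ar rd.
have [h3 h4] := flow_zero fw2 r0a (etrans (esym fE) f0) (etrans (esym gE) g0) ar rd.
by rewrite h1 h3; split=> // ar'; rewrite h2 // h4.
Qed.

Lemma eq_within_continuous_left f h a : {within [set x | r0 <= x], continuous f} ->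
  {within [set x | r0 <= x], continuous h} -> r0 < a ->
  (forall r, r0 <= r -> r < a -> f r = h r) -> f a = h a.
Proof.
move=> /subspace_continuousP/(_ a) /= fc /subspace_continuousP/(_ a) /= hc r0a fh.
have fhc : (fun t => f t - h t) @ within [set x | r0 <= x] (nbhs a) --> f a - h a.
  by apply: cvgB; [exact/fc/ltW|exact/hc/ltW].
move/cvgrPdist_lt: fhc => H.
apply/eqP; rewrite -subr_eq0; apply/negP => /negP; rewrite -normr_gt0 => /H.
rewrite near_withinE => -[d /= d0 Hd].
pose t := Num.max r0 (a - d / 2).
have r0t : r0 <= t by rewrite le_max lexx.
have td : a - d / 2 <= t by rewrite le_max lexx orbT.
have ta : t < a by rewrite gt_max r0a gtrBl divr_gt0.
have := Hd t; rewrite /= (fh t r0t ta) subrr subr0 ltxx.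
move=> K; suff: false by []; apply: K => //.
by rewrite ger0_norm ?subr_ge0 ?(ltW ta) //; lra.
Qed.

(** If agreement failed at [x], the set [S] of times up to which the flows agree would be bounded by
    [x]; agreement passes to [sup S] by continuity and beyond it by local uniqueness, which restarts
    from both components of [P]. *)
Lemma flow_unique f1 w1 f2 w2 : is_flow f1 w1 -> is_flow f2 w2 ->
  f1 r0 = f2 r0 -> w1 r0 = w2 r0 -> forall r, r0 <= r -> f1 r = f2 r.
Proof.
move=> fw1 fw2 fE wE.
pose P x := f1 x = f2 x /\ w1 x = w2 x.
suff H x : r0 <= x -> P x by move=> r /H[].
move=> r0x; apply: contrapT => nPx.
pose S := [set s | r0 <= s /\ forall t, r0 <= t -> t <= s -> P t].
have S0 : S r0 by split=> // t r0t tr0; have -> : t = r0 by apply/le_anti/andP.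
have Sx : ubound S x.
  by move=> s [_ Hs]; rewrite leNgt; apply/negP => xs; apply/nPx/Hs => //; exact: ltW.
have hS : has_sup S by split; [exists r0|exists x].
have r0c : r0 <= sup S by apply: ub_le_sup => //; exists x.
have below t : r0 <= t -> t < sup S -> P t.
  move=> r0t tS; have := sup_adherent _ hS => /(_ (sup S - t)).
  rewrite subr_gt0 => /(_ tS)[s [_ Hs]]; rewrite subKr => ts.
  by apply: Hs => //; exact: ltW.
have Pc : P (sup S).
  move: r0c; rewrite le_eqVlt => /orP[/eqP <-//|r0c].
  case: (fw1) (fw2) => /has_deriv_continuous f1c _ w1c [/has_deriv_continuous f2c _ w2c].
  split.
    by apply: (eq_within_continuous_left f1c f2c r0c) => r r0r rc; case: (below r r0r rc).
  by apply: (eq_within_continuous_left w1c w2c r0c) => r r0r rc; case: (below r r0r rc).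
have [d d0 Hd] := flow_local_unique fw1 fw2 r0c Pc.1 Pc.2.
have Sd : S (sup S + d).
  split=> [|t r0t td]; first by lra.
  have [tc|ct] := ltP t (sup S); first exact: below.
  exact: Hd.
have : sup S + d <= sup S by apply: ub_le_sup => //; exists x.
by lra.
Qed.

End Uniqueness.

(** * Existence *)

Section Existence.
Context {R : realType}.
Variables (q theta r0 x0 v0 : R).
Hypotheses (q1 : 1 <= q) (theta1 : 1 <= theta) (r00 : 0 <= r0).
Hypothesis v0_singular : r0 = 0 -> v0 = 0.
Implicit Types (b c r s t x y : R).
Let q0 : 0 < q := q_gt0 q1.

(** Projection onto [[- c, c]] for [0 <= c]; for [c < 0] it is constantly [- c], so the bound by |c|
    holds for every [c]. *)
Definition clip c y : R := Num.max (- c) (Num.min c y).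

Lemma clip_norm c y : `|clip c y| <= `|c|.
Proof.
rewrite /clip ler_norml le_max ge_max ge_min.
have := ler_norm (- c); have := ler_norm c; rewrite normrN => h1 h2.
apply/andP; split; last by rewrite h2 h1.
by rewrite lerN2 h1.
Qed.

Lemma clip_id c y : `|y| <= c -> clip c y = y.
Proof.
by rewrite ler_norml => /andP[h1 h2]; rewrite /clip min_r // max_r.
Qed.

(* At [r0 = 0] the division yields [0], which is the intended value since then [v0 = 0]. *)
Definition rate : R := 1 + `|v0| `^ q / r0.
(** An upper barrier for |f|: its logarithmic derivative 1 + 2 [rate] r dominates (r [rate])^(1/q),
    so it grows at least as fast as the cut-off velocity allows. *)
Definition height r : R := (1 + `|x0|) * expR (r + rate * r ^+ 2).
(** A barrier for r^(1-theta) G: the summand 1 of [rate] pays for the integrated force, the other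
    summand for the initial flux. It vanishes at [r = 0]. *)
Definition slope r : R := r * rate * height r `^ q.

Lemma rate_ge1 : 1 <= rate.
Proof. by rewrite lerDl divr_ge0 ?powR_ge0. Qed.
Let rate1 := rate_ge1.
Let rate0 : 0 <= rate := le_trans ler01 rate1.

Lemma height_ge1 r : 0 <= r -> 1 + `|x0| <= height r.
Proof.
move=> rr; rewrite ler_peMr ?addr_ge0 // -expR0 ler_expR.
by rewrite addr_ge0 // mulr_ge0 // exprn_ge0.
Qed.

Lemma height_gt0 r : 0 < height r.
Proof. by rewrite mulr_gt0 ?expR_gt0 // ltr_pwDl. Qed.

Lemma height_le r s : 0 <= r -> r <= s -> height r <= height s.
Proof.
move=> rr rs; rewrite ler_wpM2l ?addr_ge0 // ler_expR lerD // ler_wpM2l //.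
by rewrite lerXn2r ?nnegrE // (le_trans rr).
Qed.

Lemma height_powR_le r s : 0 <= r -> r <= s -> height r `^ q <= height s `^ q.
Proof.
move=> rr rs; apply: (ge0_ler_powR (ltW q0)); rewrite ?nnegrE ?(ltW (height_gt0 _)) //.
exact: height_le.
Qed.

Lemma slope_ge0 r : 0 <= r -> 0 <= slope r.
Proof. by move=> rr; rewrite !mulr_ge0 ?powR_ge0. Qed.

Lemma slope_le r s : 0 <= r -> r <= s -> slope r <= slope s.
Proof.
move=> rr rs; apply: ler_pM; [exact: mulr_ge0|exact: powR_ge0|exact: ler_wpM2r|].
exact: height_powR_le.
Qed.

Lemma continuous_height : continuous height.
Proof.
move=> r; apply: cvgM; first exact: cvg_cst.
apply: (@continuous_comp _ _ _ (fun r : R => r + rate * r ^+ 2) expR); last exact: continuous_expR.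
apply: cvgD; first exact: cvg_id.
by apply: cvgM; [exact: cvg_cst|apply: cvgM; exact: cvg_id].
Qed.

Lemma continuous_slope : continuous slope.
Proof.
have -> : slope = fun r => r * rate * `|height r| `^ q.
  by apply/funext => r; rewrite /slope (ger0_norm (ltW (height_gt0 r))).
move=> r; apply: cvgM; first by apply: cvgM; [exact: cvg_id|exact: cvg_cst].
apply: (@continuous_comp _ _ _ height (fun s : R => `|s| `^ q)).
  exact: continuous_height.
exact/continuous_norm_powR/ltW.
Qed.

Lemma is_derive_height r : is_derive r 1 height (height r * (1 + 2 * rate * r)).
Proof.
pose g : R -> R := id + rate \*: (id * id).
have gE s : g s = s + rate * s ^+ 2 by rewrite /g !fctE /= expr2.
have gd : is_derive r 1 g (1 + 2 * rate * r).
  apply: is_derive_eq; rewrite /GRing.scale /=; ring.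
have := @is_deriveZ R R R (expR \o g) (1 + `|x0|) r 1 _
  (is_derive1_comp (is_derive_expR (g r)) gd).
have -> : (1 + `|x0|) \*: (expR \o g) = height.
  by apply/funext => s; rewrite /height /= gE.
by move/is_derive_eq; apply; rewrite /GRing.scale /= mulrA gE.
Qed.

(** With s = r [rate], the claim reduces to s^(1/q) <= 1 + s: since [1 <= q], the root is at most 1
    if s <= 1 and at most s otherwise. *)
Lemma slope_root_le r : 0 <= r ->
  slope r `^ q^-1 <= height r * (1 + 2 * rate * r).
Proof.
move=> rr; have s0 : 0 <= r * rate by rewrite mulr_ge0.
rewrite /slope powRM ?powR_ge0 // -powRrM mulfV ?gt_eqF // powRr1 ?(ltW (height_gt0 _)) //.
rewrite mulrC ler_wpM2l ?(ltW (height_gt0 _)) //.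
apply: (@le_trans _ _ (1 + r * rate)); last by have := s0; lra.
have qi0 : 0 <= q^-1 by rewrite invr_ge0 ltW.
have [s1|s1] := leP (r * rate) 1.
  apply: (@le_trans _ _ (1 `^ q^-1)); first by apply: ge0_ler_powR; rewrite ?nnegrE.
  by rewrite powR1 lerDl.
apply: (@le_trans _ _ (r * rate)); last by rewrite lerDr.
by apply: ler1_powR; [exact: ltW|by rewrite invf_le1].
Qed.

(** * The cut-off system: bounds and continuity *)

Definition velocity r y : R := spow q^-1 (clip (slope r) (y * r `^ (1 - theta))).
Definition force r x : R := - (`|r| `^ (theta - 1) * spow q (clip (height r) x)).
(** The index [true] is the component [f], the index [false] the flux; each right-hand side depends
    on the other component only. *)
Definition field (i : bool) r (z : bool -> R) : R :=
  if i then velocity r (z false) else force r (z true).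

Lemma velocity_norm_le r y : `|velocity r y| <= `|slope r| `^ q^-1.
Proof.
have qi0 : 0 < q^-1 by rewrite invr_gt0.
by apply: spow_norm_le => //; exact: clip_norm.
Qed.

Lemma force_norm_le r x : 0 <= r -> `|force r x| <= height r `^ q * r `^ (theta - 1).
Proof.
move=> rr; rewrite normrN normrM (ger0_norm rr) ger0_norm ?powR_ge0 // mulrC.
rewrite ler_wpM2r ?powR_ge0 //; apply: spow_norm_le => //.
by rewrite (le_trans (clip_norm _ _)) // ger0_norm // ltW // height_gt0.
Qed.

Lemma field_bound i t T z : r0 <= t -> t <= T ->
  `|field i t z| <= slope T `^ q^-1 + height T `^ q * T `^ (theta - 1).
Proof.
move=> r0t tT; have t0 := le_trans r00 r0t; have T0 := le_trans t0 tT.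
have qi0 : 0 <= q^-1 by rewrite invr_ge0 ltW.
case: i => /=.
  apply: le_trans (velocity_norm_le _ _) _; rewrite (ger0_norm (slope_ge0 t0)).
  apply: ler_wpDr; first by apply: mulr_ge0; exact: powR_ge0.
  by apply: (ge0_ler_powR qi0); rewrite ?nnegrE;
    [exact: slope_ge0|exact: slope_ge0|exact: slope_le].
apply: le_trans (force_norm_le _ t0) _; apply: ler_wpDl; first exact: powR_ge0.
apply: ler_pM; [exact: powR_ge0|exact: powR_ge0|exact: height_powR_le|].
by apply: ge0_ler_powR; rewrite ?nnegrE ?subr_ge0.
Qed.

Lemma continuous_pair_near (G : R * R -> R) t y e : {for (t, y), continuous G} ->
  0 < e -> exists2 d, 0 < d & forall t' y', `|t' - t| < d -> `|y' - y| < d ->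
    `|G (t', y') - G (t, y)| <= e.
Proof.
move=> /cvgrPdist_le H /H /nbhs_ballP[d d0 Hd]; exists d => // t' y' td yd.
by rewrite distrC; apply: Hd; split; rewrite /ball /= distrC.
Qed.

Lemma continuous_clip (f g : R * R -> R) z : {for z, continuous f} ->
  {for z, continuous g} -> {for z, continuous (fun z => clip (f z) (g z))}.
Proof.
move=> fz gz; apply: continuous_max; first exact: cvgN.
exact: continuous_min.
Qed.

Lemma continuous_fst_comp (f : R -> R) (z : R * R) : {for z.1, continuous f} ->
  {for z, continuous (fun z => f z.1)}.
Proof.
by move=> fz; apply: (@continuous_comp _ _ _ fst f); [exact: cvg_fst|exact: fz].
Qed.

(** At [t = 0] the bound |slope|^(1/q) of the velocity tends to 0 uniformly in [y], so the factor
    r^(1-theta) does no harm; for [t > 0] the velocity is a composition of continuous maps. *)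
Lemma velocity_continuous t y e : r0 <= t -> 0 < e -> exists2 d, 0 < d &
  forall t' y', `|t' - t| < d -> `|y' - y| < d ->
    `|velocity t' y' - velocity t y| <= e.
Proof.
move=> r0t e0; have qi0 : 0 < q^-1 by rewrite invr_gt0.
have := le_trans r00 r0t; rewrite le_eqVlt => /orP[/eqP t0|t0].
  have velocity0 z : velocity 0 z = 0.
    have := velocity_norm_le 0 z; rewrite /slope !mul0r normr0 powR0 ?gt_eqF //.
    by rewrite normr_le0 => /eqP.
  have /cvgrPdist_le/(_ e e0) : {for 0, continuous (fun r => `|slope r| `^ q^-1)}.
    apply: (@continuous_comp _ _ _ slope (fun s : R => `|s| `^ q^-1)).
      exact: continuous_slope.
    exact/continuous_norm_powR/ltW.
  rewrite /slope !mul0r normr0 powR0 ?gt_eqF // -/slope => -[d d0 Hd].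
  exists d => // t' y' td _; rewrite -t0 velocity0 subr0.
  apply: le_trans (velocity_norm_le _ _) _.
  have t'd : `|0 - t'| < d by move: td; rewrite -t0 subr0 sub0r normrN.
  by have := Hd t' t'd; rewrite sub0r normrN ger0_norm // powR_ge0.
apply: (@continuous_pair_near (fun z => velocity z.1 z.2)) => //.
apply: (@continuous_comp _ _ _
  (fun z : R * R => clip (slope z.1) (z.2 * z.1 `^ (1 - theta))) (spow q^-1)); last first.
  exact: continuous_spow.
apply: continuous_clip; first by apply: continuous_fst_comp; exact: continuous_slope.
apply: cvgM; first exact: cvg_snd.
apply: (@continuous_fst_comp (fun r => r `^ (1 - theta)) (t, y)).
apply: differentiable_continuous; apply/derivable1_diffP.
by apply: derivable_powR; rewrite in_itv /= andbT.
Qed.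

Lemma force_continuous t x e : 0 < e -> exists2 d, 0 < d &
  forall t' x', `|t' - t| < d -> `|x' - x| < d -> `|force t' x' - force t x| <= e.
Proof.
move=> e0; apply: (@continuous_pair_near (fun z => force z.1 z.2)) => //.
apply: cvgN; apply: cvgM.
  apply: (@continuous_fst_comp (fun r => `|r| `^ (theta - 1)) (t, x)).
  by apply: continuous_norm_powR; rewrite subr_ge0.
apply: (@continuous_comp _ _ _ (fun z : R * R => clip (height z.1) z.2) (spow q)).
  apply: continuous_clip; last exact: cvg_snd.
  by apply: continuous_fst_comp; exact: continuous_height.
exact: continuous_spow.
Qed.

Lemma field_continuous i t z e : r0 <= t -> 0 < e -> exists2 d, 0 < d &
  forall t' z', r0 <= t' -> `|t' - t| < d -> (forall j, `|z' j - z j| < d) ->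
    `|field i t' z' - field i t z| <= e.
Proof.
move=> r0t e0; case: i.
  have [d d0 H] := velocity_continuous (z false) r0t e0.
  by exists d => // t' z' _ td zd; exact: H.
have [d d0 H] := force_continuous t (z true) e0.
by exists d => // t' z' _ td zd; exact: H.
Qed.

(** Peano's theorem solves the cut-off system; [f_height] and [G_slope] show that neither cut-off
    acts, so [G] is the flux of [w] and [(f, w)] is a flow. *)
Lemma flow_exists : exists f w, [/\ is_flow q theta r0 f w, f r0 = x0 & w r0 = v0].
Proof.
pose y0 := r0 `^ (theta - 1) * spow q v0.
have [X [X0 Xd]] := peano (fun i : bool => if i then x0 else y0) field_bound
  (fun i t z e => @field_continuous i t z e).
pose f := X true; pose G := X false; pose w r := velocity r (G r).
have fd x : r0 <= x -> has_deriv_from r0 f x (w x) by exact: (Xd true).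
have Gd x : r0 <= x -> has_deriv_from r0 G x (force x (f x)) by exact: (Xd false).
have f0 : f r0 = x0 := X0 true.
have G0 : G r0 = y0 := X0 false.
have fc := has_deriv_continuous fd.
have Gc := has_deriv_continuous Gd.
have qi0 : 0 < q^-1 by rewrite invr_gt0.
(* This bound and [G_slope] rest on the cut-off right-hand sides alone, so there is no circularity
   between them. *)
have f_height r : r0 <= r -> `|f r| <= height r.
  move=> r0r.
  have hc : {within `[r0, r], continuous height}.
    by apply: continuous_subspaceT; exact: continuous_height.
  have K := @norm_increment_le R f w height _ r0 r r0r _ (within_itvW (lexx r0) fc) hc.
  have {}K : `|f r - f r0| <= height r - height r0.
    apply: K => x /andP[r0x xr]; split.
    - by apply: has_deriv_is_derive (fd _ (ltW r0x)) r0x.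
    - exact: is_derive_height.
    have x0' := le_trans r00 (ltW r0x).
    apply: le_trans (velocity_norm_le _ _) _.
    by rewrite (ger0_norm (slope_ge0 x0')); exact: slope_root_le.
  have -> : f r = (f r - f r0) + f r0 by ring.
  apply: le_trans (ler_normD _ _) _; rewrite {2}f0.
  by have := height_ge1 r00; lra.
have G_slope r : r0 <= r -> 0 < r -> `|G r * r `^ (1 - theta)| <= slope r.
  move=> r0r rgt0; have P0 : 0 < r `^ (theta - 1) by rewrite powR_gt0.
  have PE : r `^ (1 - theta) = (r `^ (theta - 1))^-1 by rewrite -powRN opprB.
  rewrite normrM (ger0_norm (powR_ge0 _ _)) PE ler_pdivrMr //.
  have K : `|G r - G r0| <= height r `^ q * mass theta r0 r.
    apply: (flux_increment_le theta1 r00 (lexx r0) r0r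
      (fun x r0x => has_deriv_is_derive (Gd _ (ltW r0x)) r0x)
      (within_itvW (lexx r0) Gc)) => x /andP[r0x xr].
    have x0' := le_trans r00 (ltW r0x).
    apply: le_trans (force_norm_le _ x0') _.
    by rewrite ler_wpM2r ?powR_ge0 // height_powR_le // ltW.
  have h1 : 1 <= height r `^ q.
    apply: (@le_trans _ _ (1 `^ q)); first by rewrite powR1.
    apply: (ge0_ler_powR (ltW q0)); rewrite ?nnegrE //.
      exact/ltW/height_gt0.
    by apply: le_trans (height_ge1 (ltW rgt0)); rewrite lerDl.
  have h0 := le_trans ler01 h1.
  have {}K : `|G r - G r0| <= height r `^ q * r `^ (theta - 1) * r.
    apply: le_trans K _; rewrite -mulrA ler_wpM2l // (le_trans (mass_le theta1 r00 r0r)) //.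
    by rewrite ler_wpM2l ?(ltW P0) // gerBl.
  (* For [0 < r0], the inequality 1 <= r / r0, the bound [h1] and monotonicity of the weight enlarge
     the initial flux to the second part of [slope] times the weight; for [r0 = 0] it is 0. *)
  have g0 : `|G r0| <= `|v0| `^ q / r0 * r * height r `^ q * r `^ (theta - 1).
    have [r0E|r0n] := eqVneq r0 0.
      by rewrite G0 /y0 v0_singular // spow0 mulr0 normr0 !mulr_ge0 ?powR_ge0 ?invr_ge0 // ltW.
    have r0p : 0 < r0 by rewrite lt_neqAle eq_sym r0n r00.
    rewrite G0 /y0 normrM (ger0_norm (powR_ge0 _ _)) mulrC spow_norm //.
    apply: ler_pM; rewrite ?powR_ge0 //; last first.
      by apply: ge0_ler_powR; rewrite ?nnegrE ?subr_ge0 // ltW.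
    rewrite -[X in X <= _]mulr1; apply: ler_pM; rewrite ?powR_ge0 //.
    by rewrite mulrAC -mulrA ler_peMr ?powR_ge0 // ler_pdivlMr ?mul1r.
  have -> : G r = (G r - G r0) + G r0 by ring.
  apply: le_trans (ler_normD _ _) _; apply: le_trans (lerD K g0) _.
  by rewrite /slope /rate le_eqVlt; apply/orP; left; apply/eqP; ring.
have w_slope0 : r0 = 0 -> w 0 = 0.
  move=> r0E; have := velocity_norm_le 0 (G 0).
  by rewrite /slope !mul0r normr0 powR0 ?gt_eqF // normr_le0 => /eqP.
have wE r : r0 <= r -> 0 < r -> w r = spow q^-1 (G r * r `^ (1 - theta)).
  by move=> r0r rgt0; rewrite /w /velocity clip_id // G_slope.
have powE r : 0 < r -> r `^ (theta - 1) * r `^ (1 - theta) = 1.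
  move=> rgt0; have -> : 1 - theta = - (theta - 1) by ring.
  by rewrite powRN mulfV // gt_eqF // powR_gt0.
have fluxE r : r0 <= r -> G r = flux q theta w r.
  move=> r0r; rewrite /flux; have := le_trans r00 r0r.
  rewrite le_eqVlt => /orP[/eqP rE|rgt0].
    have r0E : r0 = 0 by apply: le_anti; rewrite r00 rE r0r.
    by rewrite -rE w_slope0 // spow0 mulr0 -{1}r0E G0 /y0 v0_singular // spow0 mulr0.
  by rewrite wE // spowK // mulrCA powE // mulr1.
exists f, w; split=> //.
  split=> // [x r0x|].
    have x0' := le_trans r00 r0x.
    have -> : - (x `^ (theta - 1) * spow q (f x)) = force x (f x).
      by rewrite /force ger0_norm // clip_id // f_height.
    exact: eq_has_deriv_from r0x fluxE (Gd x r0x).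
  (* Continuity of [w] comes from continuity of the cut-off velocity along the solution, which
     includes [r = 0]. *)
  apply/subspace_continuousP => x /= r0x; apply/cvgrPdist_le => e e0.
  have [d d0 Hd] := field_continuous true (fun j => X j x) r0x e0.
  move/subspace_continuousP: fc => /(_ x r0x)/cvgrPdist_lt/(_ d d0) fnear.
  move/subspace_continuousP: Gc => /(_ x r0x)/cvgrPdist_lt/(_ d d0) Gnear.
  near=> t; rewrite distrC; apply: (Hd t (fun j => X j t)).
  - by near: t; rewrite near_withinE; apply: nearW.
  - by near: t; rewrite near_withinE; exists d => // t /=; rewrite distrC.
  by case; rewrite distrC; near: t.
have := r00; rewrite le_eqVlt => /orP[/eqP r0E|r0p].
  by rewrite v0_singular // -r0E w_slope0.
rewrite wE // G0 /y0 mulrAC powE // mul1r.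
by have := spowK v0 qi0; rewrite invrK.
Unshelve. all: by end_near.
Qed.

End Existence.

(** * Correspondence between flows and solutions of the equation *)

Lemma flow_solution (R : realType) (p theta r0 h0 h0' : R) (f w : R -> R) :
  2 <= p -> 1 <= theta -> 0 <= r0 -> is_flow (p - 1) theta r0 f w ->
  f r0 = h0 -> w r0 = h0' -> is_solution p theta r0 h0 h0' f.
Proof.
move=> p2 theta1 r00 [fd gd wc] f0 w0.
exists w, (fun r => - (r `^ (theta - 1) * phip p (f r))).
have fluxE : (fun r => r `^ (theta - 1) * phip p (w r)) = flux (p - 1) theta w.
  by apply/funext => r; rewrite phipE.
split; first by [].
split.
  rewrite fluxE; split=> [x /gd|]; first by rewrite phipE.
  have := has_deriv_continuous fd => /subspace_continuousP fc.
  apply/subspace_continuousP => x /= r0x.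
  (* The weight is replaced by |r|^(theta-1), continuous everywhere and equal to it on the
     half-line. *)
  have : (fun r => - (`|r| `^ (theta - 1) * spow (p - 1) (f r))) @
      within [set y | r0 <= y] (nbhs x) --> - (`|x| `^ (theta - 1) * spow (p - 1) (f x)).
    apply: cvgN; apply: cvgM.
      by apply: cvg_within_filter; apply: continuous_norm_powR; rewrite subr_ge0.
    apply: continuous_cvg; last exact: fc.
    by apply: continuous_spow; lra.
  rewrite /from_subspace phipE // (ger0_norm (le_trans r00 r0x)); apply: cvg_trans.
  apply: near_eq_cvg; rewrite near_withinE; apply: nearW => y /= r0y.
  by rewrite phipE // ger0_norm // (le_trans r00).
by split=> // r _; rewrite addNr.
Qed.

Lemma solution_flow (R : realType) (p theta r0 h0 h0' : R) (f : R -> R) :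
  2 <= p -> is_solution p theta r0 h0 h0' f ->
  exists w, [/\ is_flow (p - 1) theta r0 f w, f r0 = h0 & w r0 = h0'].
Proof.
move=> p2 [w [dg [[fd wc] [[gd _] [eqn [f0 w0]]]]]]; exists w; split=> //; split=> // x r0x.
have fluxE : (fun r => r `^ (theta - 1) * phip p (w r)) = flux (p - 1) theta w.
  by apply/funext => r; rewrite phipE.
have -> : - (x `^ (theta - 1) * spow (p - 1) (f x)) = dg x.
  by rewrite -phipE //; apply/esym/eqP; rewrite -addr_eq0 eqn.
by rewrite -fluxE; exact: gd.
Qed.

Theorem mainTheorem16 (R : realType) (p theta r0 h0 h0' : R)
  (hp : 2 <= p) (htheta : 1 <= theta) (hr0 : 0 <= r0)
  (hh : r0 = 0 -> h0' = 0) :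
  exists phi : R -> R,
    is_solution p theta r0 h0 h0' phi /\
    forall psi : R -> R, is_solution p theta r0 h0 h0' psi ->
      forall r, r0 <= r -> psi r = phi r.
Proof.
have q1 : 1 <= p - 1 by lra.
have [phi [w [fw f0 w0]]] := flow_exists h0 q1 htheta hr0 hh.
exists phi; split; first exact: flow_solution fw f0 w0.
move=> psi /(solution_flow hp)[v [fv g0 v0]] r r0r.
apply: (flow_unique q1 htheta hr0 fv fw) => //; first by rewrite g0.
by rewrite v0.
Qed.
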